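(* The alternating minimization (AM), proximal minimization (PMA), and majorization minimization (MM) methods are equivalent.
   Context: Let $X$ and $Y$ be arbitrary nonempty sets. PMA: let $f:X\to\mathbb{R}$; the objective is to minimize $f(x)$ over $x\in X$. Let $d:X\times X\to\mathbb{R}_+$ (where $\mathbb{R}_+$ denotes the nonnegative reals) be a ''distance'', meaning only that $d(x,z)\ge 0$ for all $x,z\in X$ and $d(x,x)=0$ for all $x\in X$. At each step one minimizes $f(x)+d(x,x^{k-1})$ over $x\in X$ to get $x^k$. MM (also called optimization transfer): let $f:X\to\mathbb{R}$; the objective is to minimize $f(x)$ over $x\in X$. A second, ''majorizing'' function $g(x|z)$ is introduced, with the properties $g(x|z)\ge f(x)$ for all $x$ and $z$ in $X$, and $g(x|x)=f(x)$ for all $x\in X$. At each step one minimizes $g(x|x^{k-1})$ over $x\in X$ to get $x^k$. AM: let $\Phi:X\times Y\to\mathbb{R}_+$. The objective is to find $\hat x\in X$ and $\hat y\in Y$ such that $\Phi(\hat x,\hat y)\le\Phi(x,y)$ for all $x\in X$ and $y\in Y$. For each $k$ one minimizes $\Phi(x,y^{k-1})$ over $x\in X$ to get $x^{k-1}$, and then minimizes $\Phi(x^{k-1},y)$ over $y\in Y$ to get $y^k$. For each $x\in X$, $y(x)\in Y$ denotes an element such that $\Phi(x,y)\ge\Phi(x,y(x))$ for all $y\in Y$; then $y^k=y(x^{k-1})$. ''Equivalent'' is meant in the sense that an algorithm of any one of these three types can be viewed as an algorithm of each of the other two types. *)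

(* Defs.v *)
From Stdlib Require Export Reals.
Open Scope R_scope.

Definition is_min {T : Type} (h : T -> R) (a : T) : Prop :=
  forall b : T, h a <= h b.

Record PMA (X : Type) := {
  pma_f : X -> R;
  pma_d : X -> X -> R;
  pma_d_ge0 : forall x z : X, 0 <= pma_d x z;
  pma_d_diag : forall x : X, pma_d x x = 0
}.
Arguments pma_f {X}.
Arguments pma_d {X}.

Definition pma_obj {X : Type} (P : PMA X) (x z : X) : R :=
  pma_f P x + pma_d P x z.

Definition PMA_run {X : Type} (P : PMA X) (x : nat -> X) : Prop :=
  forall k : nat, is_min (fun u => pma_obj P u (x k)) (x (S k)).

(* [mm_g M x z] is g(x|z). *)
Record MM (X : Type) := {
  mm_f : X -> R;
  mm_g : X -> X -> R;
  mm_g_maj : forall x z : X, mm_f x <= mm_g x z;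
  mm_g_diag : forall x : X, mm_g x x = mm_f x
}.
Arguments mm_f {X}.
Arguments mm_g {X}.

Definition MM_run {X : Type} (M : MM X) (x : nat -> X) : Prop :=
  forall k : nat, is_min (fun u => mm_g M u (x k)) (x (S k)).

(* The choice x |-> y(x) of a minimizer of Phi(x, .) is part of the data of the
   algorithm. *)
Record AM (X Y : Type) := {
  am_phi : X -> Y -> R;
  am_y : X -> Y;
  am_phi_ge0 : forall (x : X) (y : Y), 0 <= am_phi x y;
  am_y_min : forall x : X, is_min (am_phi x) (am_y x)
}.
Arguments am_phi {X Y}.
Arguments am_y {X Y}.

Definition AM_solution {X Y : Type} (A : AM X Y) (x : X) (y : Y) : Prop :=
  forall (u : X) (v : Y), am_phi A x y <= am_phi A u v.

(* y 0 is an arbitrary starting point; x k minimizes Phi(., y k), and then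
   y (k+1) = y(x k). *)
Definition AM_run {X Y : Type} (A : AM X Y) (x : nat -> X) (y : nat -> Y)
  : Prop :=
  forall k : nat,
    is_min (fun u => am_phi A u (y k)) (x k) /\ y (S k) = am_y A (x k).

(* Same problem, same function minimized at every step, same iterates. *)
Definition PMA_MM_same {X : Type} (P : PMA X) (M : MM X) : Prop :=
  (forall x : X, pma_f P x = mm_f M x) /\
  (forall x z : X, pma_obj P x z = mm_g M x z) /\
  (forall x : nat -> X, PMA_run P x <-> MM_run M x).

(* Agreement of an AM algorithm with a one-variable algorithm that minimizes
   f by minimizing [g . z] from the current iterate z, [run] being its
   sequences of iterates.
   - The step functions g(x, z) and Phi(x, y(z)) are compared through the order
     they induce, not by equality of values: Phi is nonnegative whereas f and g
     may be unbounded below.  When g(x, x) = f(x), taking z = x gives the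
     comparison of f(x) with Phi(x, y(x)).
   - Solutions of the two problems correspond.
   - An AM run starts from y 0, a one-variable run from x 0.  So the x-part of
     an AM run is a run, its first term being the minimizer obtained from y 0;
     conversely a run p is the AM run started at y 0 = y(p 0), whose k-th
     x-iterate is p (k+1). *)
Definition AM_agrees {X Y : Type} (A : AM X Y)
    (f : X -> R) (g : X -> X -> R) (run : (nat -> X) -> Prop) : Prop :=
  (forall x z x' z' : X,
     g x z <= g x' z' <->
     am_phi A x (am_y A z) <= am_phi A x' (am_y A z')) /\
  (forall (x : X) (y : Y), AM_solution A x y -> is_min f x) /\
  (forall x : X, is_min f x -> AM_solution A x (am_y A x)) /\
  (forall (x : nat -> X) (y : nat -> Y),
     AM_run A x y <->
     is_min (fun u => am_phi A u (y O)) (x O) /\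
     (forall k : nat, y (S k) = am_y A (x k)) /\
     run x) /\
  (forall p : nat -> X,
     run p <-> AM_run A (fun k => p (S k)) (fun k => am_y A (p k))).

Definition AM_PMA_same {X Y : Type} (A : AM X Y) (P : PMA X) : Prop :=
  AM_agrees A (pma_f P) (pma_obj P) (PMA_run P).

Definition AM_MM_same {X Y : Type} (A : AM X Y) (M : MM X) : Prop :=
  AM_agrees A (mm_f M) (mm_g M) (MM_run M).

(* Main.v *)
(* PMA and MM are the same via g(x|z) = f(x) + d(x,z).  An AM algorithm becomes
   an MM algorithm by eliminating y: f(x) = Phi(x, y(x)) and
   g(x|z) = Phi(x, y(z)).  Conversely Phi = exp o g, with y(x) = x, is
   nonnegative and induces the same order on pairs as g, and minimization
   only depends on that order. *)
Require Import Defs.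
From Stdlib Require Import Reals Lra.
Open Scope R_scope.

Lemma exp_le_iff (a b : R) : a <= b <-> exp a <= exp b.
Proof.
split; intros [H | H].
- left; now apply exp_increasing.
- right; now rewrite H.
- left; now apply exp_lt_inv.
- right; now apply exp_inv.
Qed.

(** Every clause of [AM_agrees] involves values of [g] and Phi only through inequalities, so
    matching orders, together with the diagonal identity, suffice. Keeping [run] abstract lets one
    proof serve both PMA and MM. *)
Lemma AM_agrees_of_order {X Y : Type} (A : AM X Y)
    (f : X -> R) (g : X -> X -> R) (run : (nat -> X) -> Prop)
    (g_diag : forall x : X, g x x = f x)
    (g_order : forall x z x' z' : X,
       g x z <= g x' z' <->
       am_phi A x (am_y A z) <= am_phi A x' (am_y A z'))
    (run_def : forall p : nat -> X,
       run p <-> forall k : nat, is_min (fun u => g u (p k)) (p (S k))) :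
  AM_agrees A f g run.
Proof.
assert (f_order : forall x u : X,
  f x <= f u <-> am_phi A x (am_y A x) <= am_phi A u (am_y A u)).
{ intros x u; rewrite <- !g_diag; apply g_order. }
assert (g_min : forall x z : X,
  is_min (fun u => g u z) x <-> is_min (fun u => am_phi A u (am_y A z)) x).
{ intros x z; split; intros H u; apply g_order, H. }
split; [exact g_order|split; [|split; [|split]]].
- intros x y H u; apply f_order.
  (* Phi(x, y(x)) <= Phi(x, y) by the choice of y(x), and the solution (x, y) is at least as good as
     (u, y(u)). *)
  apply Rle_trans with (am_phi A x y); [apply am_y_min|apply H].
- intros x H u v.
  apply Rle_trans with (am_phi A u (am_y A u)); [|apply am_y_min].
  apply f_order, H.
- intros x y; split.
  + intros H; split; [apply H|split; [intros k; apply H|]].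
    apply run_def; intros k; apply g_min.
    (* Since y(x k) is [y (S k)], the MM-type step from [x k] is the AM minimization number
       [S k]. *)
    rewrite <- (proj2 (H k)); apply H.
  + intros [H0 [Hy Hx]] k; split; [|apply Hy].
    (* The start [y O] need not have the form y(z), so the first minimization is not a step of [run]
       and comes from [H0]. *)
    destruct k as [|k]; [exact H0|].
    rewrite Hy; apply g_min; apply -> run_def; exact Hx.
- intros p; rewrite run_def; split.
  + intros H k; split; [apply g_min, H|reflexivity].
  + intros H k; apply g_min, H.
Qed.

Definition MM_of_PMA {X : Type} (P : PMA X) : MM X.
Proof.
refine {| mm_f := pma_f P; mm_g := pma_obj P |}; unfold pma_obj.
- intros x z; pose proof (pma_d_ge0 _ P x z); lra.
- intros x; rewrite (pma_d_diag _ P); lra.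
Defined.

Definition PMA_of_MM {X : Type} (M : MM X) : PMA X.
Proof.
refine {| pma_f := mm_f M; pma_d := fun x z => mm_g M x z - mm_f M x |}.
- intros x z; pose proof (mm_g_maj _ M x z); lra.
- intros x; rewrite (mm_g_diag _ M); lra.
Defined.

Definition MM_of_AM {X Y : Type} (A : AM X Y) : MM X.
Proof.
refine {| mm_f := fun x => am_phi A x (am_y A x);
          mm_g := fun x z => am_phi A x (am_y A z) |}.
(* Majorization is the minimality of y(x) tested against y(z). *)
- intros x z; apply am_y_min.
- reflexivity.
Defined.

Definition AM_of_MM {X : Type} (M : MM X) : AM X X.
Proof.
refine {| am_phi := fun x z => exp (mm_g M x z); am_y := fun x => x |}.
- intros x z; left; apply exp_pos.
(* The identity is a valid choice of y(x): g(x|x) = f(x) <= g(x|z), so z = x minimizes g(x|.). *)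
- intros x z; apply -> exp_le_iff; rewrite (mm_g_diag _ M); apply mm_g_maj.
Defined.

Lemma PMA_of_MM_obj {X : Type} (M : MM X) (x z : X) :
  pma_obj (PMA_of_MM M) x z = mm_g M x z.
Proof. unfold pma_obj; simpl; lra. Qed.

Lemma PMA_MM_same_of_eq {X : Type} (P : PMA X) (M : MM X)
    (Hf : forall x : X, pma_f P x = mm_f M x)
    (Hg : forall x z : X, pma_obj P x z = mm_g M x z) :
  PMA_MM_same P M.
Proof.
split; [exact Hf|split; [exact Hg|]].
intros x; split; intros H k u.
- rewrite <- !Hg; apply H.
- rewrite !Hg; apply H.
Qed.

Lemma PMA_obj_diag {X : Type} (P : PMA X) (x : X) : pma_obj P x x = pma_f P x.
Proof. unfold pma_obj; rewrite (pma_d_diag _ P); lra. Qed.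

Theorem proposition1p1 (X Y : Type) (hX : inhabited X) (hY : inhabited Y) :
  (forall P : PMA X, exists M : MM X, PMA_MM_same P M) /\
  (forall M : MM X, exists P : PMA X, PMA_MM_same P M) /\
  (forall A : AM X Y, exists P : PMA X,
     (forall x z : X, pma_obj P x z = am_phi A x (am_y A z)) /\
     AM_PMA_same A P) /\
  (forall A : AM X Y, exists M : MM X,
     (forall x z : X, mm_g M x z = am_phi A x (am_y A z)) /\
     AM_MM_same A M) /\
  (forall P : PMA X, exists A : AM X X, AM_PMA_same A P) /\
  (forall M : MM X, exists A : AM X X, AM_MM_same A M).
Proof.
split; [|split; [|split; [|split; [|split]]]].
- intros P; exists (MM_of_PMA P).
  apply PMA_MM_same_of_eq; reflexivity.
- intros M; exists (PMA_of_MM M).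
  apply PMA_MM_same_of_eq; [reflexivity|apply PMA_of_MM_obj].
(* The resulting distance is d(x,z) = Phi(x, y(z)) - Phi(x, y(x)). *)
- intros A; exists (PMA_of_MM (MM_of_AM A)).
  split; [apply (PMA_of_MM_obj (MM_of_AM A))|].
  apply AM_agrees_of_order; [apply PMA_obj_diag| |reflexivity].
  intros x z x' z'; rewrite !PMA_of_MM_obj; reflexivity.
- intros A; exists (MM_of_AM A); split; [reflexivity|].
  apply AM_agrees_of_order; reflexivity.
(* Here Phi(x,z) = exp(f(x) + d(x,z)). *)
- intros P; exists (AM_of_MM (MM_of_PMA P)).
  apply AM_agrees_of_order; [apply PMA_obj_diag| |reflexivity].
  intros; apply exp_le_iff.
- intros M; exists (AM_of_MM M).
  apply AM_agrees_of_order; [apply mm_g_diag| |reflexivity].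
  intros; apply exp_le_iff.
Qed.
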